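(* Every uniformizable ladder system $\mathcal L=(L_\alpha:\alpha\in\mathrm{Lim})$ on $\omega_1$ is semi-proximal; that is, if $\mathcal L$ is uniformizable then $\Psi(\mathcal L)$ is a semi-proximal space.
   Context: $\mathrm{Lim}$ is the set of all (nonzero) countable limit ordinals. A ladder system is a family $\mathcal L=(L_\alpha:\alpha\in\mathrm{Lim})$ where each $L_\alpha$ is a cofinal subset of $\alpha$ of order type $\omega$. It is uniformizable if for each family of functions $f_\alpha:L_\alpha\to\omega$ ($\alpha\in\mathrm{Lim}$) there is a function $F:\omega_1\to\omega$ such that for every $\alpha\in\mathrm{Lim}$, $F(\beta)=f_\alpha(\beta)$ for all but finitely many $\beta\in L_\alpha$. $\Psi(\mathcal L)$ is the space with underlying set $(\omega_1\times\{0\})\cup(\mathrm{Lim}\times\{1\})$, in which $\omega_1\times\{0\}$ is open and discrete, and for $\alpha\in\mathrm{Lim}$ a local basis at $(\alpha,1)$ is $\{\{(\alpha,1)\}\cup((L_\alpha\setminus\xi)\times\{0\}) : \xi<\alpha\}$. Proximal game on a uniform space $(Z,\mathbb U)$: for an entourage $U$ write $U[x]=\{y\in Z : (x,y)\in U\}$. At inning $0$ Player I plays $U_0\in\mathbb U$ and Player II plays $x_0\in Z$; at inning $n+1$ Player I plays $U_{n+1}\in\mathbb U$ with $U_{n+1}\subseteq U_n$ and Player II plays $x_{n+1}\in U_n[x_n]$. Player I wins if $(x_n)_{n\in\omega}$ converges in the topology induced by $\mathbb U$ or $\bigcap_{n\in\omega}U_n[x_n]=\emptyset$; otherwise Player II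 wins. $(Z,\mathbb U)$ is semi-proximal if Player II has no winning strategy. A strategy for Player II assigns a legal move to each finite sequence of moves of Player I; it is winning if Player II wins every run following it. A topological space is semi-proximal if there is a uniformity $\mathbb U$ inducing its topology for which the uniform space is semi-proximal. A ladder system $\mathcal L$ is called semi-proximal if $\Psi(\mathcal L)$ is. *)

(* Defs.v *)
From HB Require Import structures.
From mathcomp Require Import all_boot all_order.
From mathcomp Require Import all_classical wochoice topology.
Set Implicit Arguments.
Unset Strict Implicit.
Unset Printing Implicit Defensive.
Import Order.TTheory.
Local Open Scope classical_set_scope.
Local Open Scope order_scope.

(** The ordinal omega_1 is represented, up to isomorphism, by an arbitrary
    uncountable well-order [W] all of whose proper initial segments are
    countable; an element [a] of [W] stands for the countable ordinal
    [{b | b < a}]. *)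
Definition is_omega1 (d : Order.disp_t) (W : orderType d) : Prop :=
  [/\ @well_order W <=%O,
      ~ countable [set: W] &
      forall a : W, countable [set b | b < a]].

Definition Lim (d : Order.disp_t) (W : orderType d) : set W :=
  [set a | (exists b, b < a) /\
           forall b, b < a -> exists2 c, b < c & c < a].
Arguments Lim {d} W _ : assert.

Definition cofinal_in (d : Order.disp_t) (W : orderType d)
    (A : set W) (a : W) : Prop :=
  A `<=` [set b | b < a] /\ forall b, b < a -> exists2 c, A c & b <= c.

Definition order_type_omega (d : Order.disp_t) (W : orderType d)
    (A : set W) : Prop :=
  exists2 e : nat -> W, {mono e : m n / (m < n)%N >-> m < n} & range e = A.

(** Below, the sets [Lim W] and [L a] are also used as the corresponding
    subtypes (coercion [set_type]). *)
Definition is_ladder_system (d : Order.disp_t) (W : orderType d)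
    (L : Lim W -> set W) : Prop :=
  forall a : Lim W, cofinal_in (L a) (val a) /\ order_type_omega (L a).

Definition uniformizable (d : Order.disp_t) (W : orderType d)
    (L : Lim W -> set W) : Prop :=
  forall f : (forall a : Lim W, L a -> nat),
  exists F : W -> nat,
    forall a : Lim W, finite_set [set b : L a | F (val b) <> f a b].

(** [inl b] is the isolated point (b, 0) and [inr a] is the point (a, 1). *)
Definition Psi (d : Order.disp_t) (W : orderType d) (L : Lim W -> set W) :
  Type := (W + Lim W)%type.

Section PsiTopology.
Context (d : Order.disp_t) (W : orderType d) (L : Lim W -> set W).

HB.instance Definition _ := Choice.copy (Psi L) (W + Lim W)%type.

Definition Psi_basic (a : Lim W) (xi : W) : set (Psi L) :=
  [set inr a] `|` inl @` [set b | L a b /\ xi <= b].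

Definition Psi_nbhs (p : Psi L) : set_system (Psi L) :=
  match p with
  | inl b => [set A | A (inl b)]
  | inr a => filter_from [set xi | xi < val a] (Psi_basic a)
  end.

HB.instance Definition _ := hasNbhs.Build (Psi L) Psi_nbhs.

Let Psi_nbhs_filter (p : Psi L) : ProperFilter (nbhs p).
Proof.
case: p => [b|a]; first by split => //; split => // P Q PQ; exact: PQ.
apply: filter_from_proper; last by move=> xi _; exists (inr a); left.
apply: filter_from_filter.
  by have [[b ba] _] := set_mem (valP a); exists b.
move=> x y xa ya; exists (Order.max x y); first by rewrite /= gt_max xa.
move=> q [->|[b [Lb]]]; first by split; left.
by rewrite ge_max => /andP[xb yb] <-; split; right; exists b.
Qed.

Let Psi_nbhs_singleton (p : Psi L) (A : set (Psi L)) : nbhs p A -> A p.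
Proof. by case: p => [b //|a [xi _]]; apply; left. Qed.

Let Psi_nbhs_nbhs (p : Psi L) (A : set (Psi L)) :
  nbhs p A -> nbhs p (nbhs^~ A).
Proof.
case: p => [b //|a [xi xia sA]]; exists xi => // q [->|[b Lb <-]].
  by exists xi.
by apply: sA; right; exists b.
Qed.

HB.instance Definition _ := Nbhs_isNbhsTopological.Build (Psi L)
  Psi_nbhs_filter Psi_nbhs_singleton Psi_nbhs_nbhs.

End PsiTopology.

Section ProximalGame.
Context {Z : uniformType}.
Implicit Types (s : seq (set (Z * Z))) (U V : set (Z * Z)).

(** A finite sequence of moves of Player I; the default value of [nth] is
    irrelevant. *)
Definition legal_moves s : Prop :=
  (forall i, (i < size s)%N -> entourage (nth setT s i)) /\
  (forall i, (i.+1 < size s)%N -> nth setT s i.+1 `<=` nth setT s i).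

(** [sigma [:: U_0; ...; U_n]] is the answer [x_n] of Player II; the values of
    [sigma] outside nonempty legal sequences are irrelevant.  The opening move
    [x_0] is unconstrained. *)
Definition is_strategyII (sigma : seq (set (Z * Z)) -> Z) : Prop :=
  forall s U V, legal_moves (rcons (rcons s U) V) ->
    xsection U (sigma (rcons s U)) (sigma (rcons (rcons s U) V)).

Definition winsI (U : nat -> set (Z * Z)) (x : nat -> Z) : Prop :=
  (exists l : Z, x @ \oo --> l) \/ \bigcap_n xsection (U n) (x n) = set0.

Definition winning_strategyII (sigma : seq (set (Z * Z)) -> Z) : Prop :=
  is_strategyII sigma /\
  forall U : nat -> set (Z * Z),
    (forall n, entourage (U n)) -> (forall n, U n.+1 `<=` U n) ->
    ~ winsI U (fun n => sigma (mkseq U n.+1)).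

End ProximalGame.

Definition semi_proximal_uniform (Z : uniformType) : Prop :=
  ~ exists sigma : seq (set (Z * Z)) -> Z, winning_strategyII sigma.

(** [m] ranges over the uniformities on [T] whose neighborhood filters are those
    of the given topology of [T]. *)
Definition semi_proximal (T : topologicalType) : Prop :=
  exists m : Nbhs_isUniform_mixin T,
    semi_proximal_uniform (HB.pack_for uniformType T m).

(* Main.v *)
(** The uniformity generated by all open equivalence relations is used. Player I
    fixes countably many locally constant functions [e i] separating points and,
    given points p_0, p_1, ..., plays at inning n the equivalence relation of
    having the same values [e i] and of lying in the same sets [B (p i) j] for
    i, j <= n, where [B p] is a clopen neighborhood base at p. If Player I
    loses, the classes of the answers of Player II intersect in a single point,
    and this point is none of the p_i, since otherwise the answers would
    converge to it. Against a winning strategy, Player I can therefore force a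
    different point after any finite sequence of moves by inserting there the
    point obtained so far; a Cantor scheme of plays then gives 2^omega distinct
    points in Psi(L).

    On the other hand, if L is uniformizable then the power set of Psi(L) embeds
    in 2^omega (Devlin and Shelah), so that there are fewer than 2^omega points.
    This embedding, restricted to singletons, also provides the reals from which
    the separating functions [e i] are obtained by uniformization. *)

Require Import Defs.
From mathcomp Require Import all_boot all_order.
From mathcomp Require Import all_classical wochoice topology.
Set Implicit Arguments.
Unset Strict Implicit.
Unset Printing Implicit Defensive.
Import Order.TTheory.
Local Open Scope classical_set_scope.
Local Open Scope order_scope.

Lemma near_forall_leq (T : Type) (F : set_system T) (P : nat -> set T) n :
  Filter F -> (forall i, (i <= n)%N -> F (P i)) ->
  F [set x | forall i, (i <= n)%N -> P i x].
Proof.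
move=> FF FP; have : \forall x \near F, forall i : 'I_n.+1, P i x.
  by apply: filter_forall => i; apply: FP; rewrite -ltnS.
by apply: filterS => x Px i; rewrite -ltnS => ltin; exact: (Px (Ordinal ltin)).
Qed.

(** * Uniformities generated by open equivalence relations *)

Section OpenEquivalences.
Context {T : topologicalType}.

Definition open_equivalence (R : set (T * T)) : Prop :=
  [/\ forall x, R (x, x), forall x y, R (x, y) -> R (y, x),
      forall x y z, R (x, y) -> R (y, z) -> R (x, z) &
      forall x, \forall y \near x, R (x, y)].

Definition locally_constant (X : Type) (f : T -> X) : Prop :=
  forall x, \forall y \near x, f x = f y.

Lemma open_equivalence_kernel (X : Type) (f : T -> X) :
  locally_constant f -> open_equivalence [set xy | f xy.1 = f xy.2].
Proof. by move=> fP; split=> //= x y z -> ->. Qed.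

Lemma open_equivalenceI (R S : set (T * T)) :
  open_equivalence R -> open_equivalence S -> open_equivalence (R `&` S).
Proof.
move=> [R1 R2 R3 R4] [S1 S2 S3 S4]; split.
- by move=> x; split.
- by move=> x y [Rxy Sxy]; split; [apply: R2|apply: S2].
- move=> x y z [Rxy Sxy] [Ryz Syz].
  by split; [apply: R3 Rxy Ryz|apply: S3 Sxy Syz].
- by move=> x; apply: filterI; [exact: R4|exact: S4].
Qed.

Definition open_equivalence_entourage : set_system (T * T) :=
  filter_from open_equivalence id.

Lemma open_equivalence_entourage_filter : Filter open_equivalence_entourage.
Proof.
apply: filter_from_filter.
  by exists setT; split=> // x; exact: filterT.
by move=> R S hR hS; exists (R `&` S) => //; exact: open_equivalenceI.
Qed.

Variable B : T -> nat -> set T.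
Hypothesis B_clopen : forall p j, locally_constant (B p j).
Hypothesis B_mem : forall p j, B p j p.
Hypothesis B_base : forall p A, nbhs p A -> exists j, B p j `<=` A.

Lemma nbhs_open_equivalence : nbhs = nbhs_ open_equivalence_entourage.
Proof.
apply/funext => p; apply/seteqP; split=> A.
  move=> /B_base[j BA].
  pose R := [set xy : T * T | B p j xy.1 = B p j xy.2].
  exists R; first by exists R => //; exact: open_equivalence_kernel.
  by move=> y /xsectionP /= Bpy; apply: BA; rewrite -Bpy.
move=> [U [R [_ _ _ Rop] RU] UA].
by apply: filterS (Rop p) => y /RU Uy; apply/UA/xsectionP.
Qed.

Definition open_equivalence_uniform_mixin : Nbhs_isUniform_mixin T.
Proof.
refine (@Nbhs_isUniform_mixin.Build T open_equivalence_entourage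
  open_equivalence_entourage_filter _ _ _ nbhs_open_equivalence).
- by move=> U [R [Rr _ _ _] RU] [x y]; rewrite /diagonal /= => ->; exact/RU/Rr.
- move=> U [R hR RU]; exists R => // -[x y] Rxy; apply: RU.
  by case: hR => _ Rs _ _; apply: Rs.
- move=> U [R hR RU]; exists R; first by exists R.
  move=> [x z] [y Rxy Ryz]; apply: RU.
  by case: hR => _ _ Rt _; apply: Rt Rxy Ryz.
Defined.

End OpenEquivalences.

(* [C p n] is the class of the answer of Player II at inning n when Player I
   follows the points [p 0], ..., [p n]. *)
Section CantorScheme.
Context {T : Type} (C : (nat -> T) -> nat -> set T).
Variable t0 : T.
Hypothesis C_local : forall p q n,
  (forall i, (i <= n)%N -> p i = q i) -> C p n = C q n.
Hypothesis C_sep : forall z z', z <> z' -> exists k, forall n p q w,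
  (k <= n)%N -> C p n z -> C q n z' -> C p n w -> ~ C q n w.
Hypothesis C_avoid : forall p, exists z, forall n, C p n z /\ z <> p n.

Let agree n (p q : nat -> T) := forall i, (i < n)%N -> p i = q i.

(** If [p] leads to [z], repeating [z] from inning [n] on leads to a point other than [z]; late
    classes of these two plays are disjoint. *)
Let C_split p n : exists s : (bool -> nat -> T) * nat,
  [/\ forall b, agree n p (s.1 b), (n <= s.2)%N &
      forall w, C (s.1 true) s.2 w -> ~ C (s.1 false) s.2 w].
Proof.
have [z zP] := C_avoid p.
pose q i := if (i < n)%N then p i else z.
have [z' z'P] := C_avoid q.
have zz' : z <> z' by have [_] := z'P n; rewrite /q ltnn => + /esym.
have [k kP] := C_sep zz'.
exists (fun b : bool => if b then p else q, maxn n k); split=> /=.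
- by case=> // i; rewrite /q => ->.
- exact: leq_maxl.
- move=> w; apply: (kP _ _ _ _ (leq_maxr n k)); first by case: (zP (maxn n k)).
  by case: (z'P (maxn n k)).
Qed.

Theorem cantor_scheme : exists f : (nat -> bool) -> T, injective f.
Proof.
have /choice[sp spP] := fun pn : (nat -> T) * nat => C_split pn.1 pn.2.
(* A node is a sequence with the number of its entries fixed so far; [.+1] since the class at inning
   [s.2] depends on entry [s.2] as well. *)
pose fix node (g : nat -> bool) k : (nat -> T) * nat :=
  if k is k'.+1 then
    let s := sp (node g k') in (s.1 (g k'), s.2.+1)
  else (fun=> t0, 0%N).
have nodeS g k : node g k.+1 =
  ((sp (node g k)).1 (g k), (sp (node g k)).2.+1) by [].
have node_size g k l : (k <= l)%N -> ((node g k).2 + (l - k) <= (node g l).2)%N.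
  elim: l => [|l IHl]; first by rewrite leqn0 => /eqP ->; rewrite addn0.
  rewrite leq_eqVlt => /predU1P[->|]; first by rewrite subnn addn0.
  rewrite ltnS => lekl; rewrite subSn// addnS nodeS /= ltnS.
  by apply: leq_trans (IHl lekl) _; have [] := spP (node g l).
have node_agree g k l : (k <= l)%N ->
  agree (node g k).2 (node g k).1 (node g l).1.
  elim: l => [|l IHl]; first by rewrite leqn0 => /eqP ->.
  rewrite leq_eqVlt => /predU1P[-> //|]; rewrite ltnS => lekl i lti.
  rewrite IHl// nodeS /=; have [/(_ (g l)) -> //] := spP (node g l).
  apply: leq_trans lti _; apply: leq_trans (node_size g _ _ lekl).
  exact: leq_addr.
pose lim g i := (node g i.+1).1 i.
have lim_agree g k : agree (node g k).2 (node g k).1 (lim g).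
  move=> i lti; rewrite /lim; have [leki|ltik] := leqP k i.+1.
    exact: node_agree.
  rewrite (node_agree g i.+1 k (ltnW ltik)) //.
  by have := node_size g 0 i.+1 isT; rewrite /= subn0.
exists (fun g => sval (cid (C_avoid (lim g)))) => g h.
case: cid => z zP; case: cid => z' z'P /= zz'.
apply/funext => k0; apply: contrapT => /eqP nk0.
(* Up to the first difference [k] both branches share a node, whose two extensions have disjoint
   classes at inning [m]. *)
have [k nk kmin] := @ex_minnP (fun k => g k != h k) (ex_intro _ k0 nk0).
have gh l : (l <= k)%N -> node g l = node h l.
  elim: l => // l IHl ltlk; rewrite !nodeS IHl ?(ltnW ltlk)//.
  suff -> : g l = h l by [].
  by apply: contraTeq ltlk => /kmin; rewrite -leqNgt.
have := lim_agree g k.+1; have := lim_agree h k.+1; rewrite !nodeS gh//=.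
set p := node h k; have [_ _ dj] := spP p; set m := (sp _).2 => ah ag.
have := (zP m).1; have := (z'P m).1.
rewrite -(C_local ah) -(C_local ag) -zz'.
by case: (g k) (h k) nk => [] [] // _ Ch Cg; apply: (dj z).
Qed.
End CantorScheme.

(** * The proximal game *)

Theorem semi_proximal_of_clopen_base (T : topologicalType) (X : Type)
    (e : nat -> T -> X) (B : T -> nat -> set T) :
  (forall i, locally_constant (e i)) ->
  (forall x y, (forall i, e i x = e i y) -> x = y) ->
  (forall p j, locally_constant (B p j)) -> (forall p j, B p j p) ->
  (forall p A, nbhs p A -> exists j, B p j `<=` A) ->
  ~ (exists f : (nat -> bool) -> T, injective f) ->
  semi_proximal T.
Proof.
move=> e_lc e_sep B_lc B_mem B_base noinj.
exists (open_equivalence_uniform_mixin B_lc B_mem B_base).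
move=> [sigma [sigma_legal sigma_wins]]; apply: noinj.
pose U (p : nat -> T) n := [set xy | forall i, (i <= n)%N ->
  e i xy.1 = e i xy.2 /\
  forall j, (j <= n)%N -> B (p i) j xy.1 = B (p i) j xy.2].
have U_equiv p n : open_equivalence (U p n).
  split.
  - by [].
  - by move=> x y Uxy i /Uxy/= [-> Bxy]; split=> // j /Bxy.
  - move=> x y z Uxy Uyz i lein; have [/= -> Bxy] := Uxy i lein.
    have [/= -> Byz] := Uyz i lein; split=> // j lejn.
    by rewrite Bxy// Byz.
  - move=> x; apply: near_forall_leq => i lein; apply: filterI => /=.
      exact: e_lc.
    by apply: near_forall_leq => j lejn; exact: B_lc.
pose x p n := sigma (mkseq (U p) n.+1).
have U_ent p n : open_equivalence_entourage (U p n) by exists (U p n).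
have U_decr p n : U p n.+1 `<=` U p n.
  move=> xy Uxy i lein; have [] := Uxy i (leqW lein); split=> // j /leqW; auto.
have play p : exists z, forall n, U p n (x p n, z) /\ z <> p n.
  have := sigma_wins (U p) (U_ent p) (U_decr p).
  rewrite /winsI not_orE => -[ncvg /eqP/set0P[z zP]]; exists z => n.
  have Uz m : U p m (x p m, z) by have /xsectionP := zP m I.
  split=> // zpn; apply: ncvg; exists z.
  move=> A /B_base[j BA]; exists (maxn n j) => // m /=.
  rewrite geq_max => /andP[lenm lejm]; apply: BA.
  have [_ /(_ j lejm)/= Bxz] := Uz m n lenm; rewrite -zpn in Bxz.
  by rewrite Bxz; exact: B_mem.
apply: (@cantor_scheme _ (fun p n => [set y | U p n (x p n, y)]) (sigma [::])).
- move=> p q n pq.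
  have Upq m : (m <= n)%N -> U p m = U q m.
    move=> lemn; apply/seteqP; split=> xy Uxy i leim.
      by rewrite -pq ?(leq_trans leim)//; exact: Uxy.
    by rewrite pq ?(leq_trans leim)//; exact: Uxy.
  have xpq : x p n = x q n.
    congr sigma; apply/eq_in_map => m; rewrite mem_iota ltnS => lemn.
    exact: Upq.
  by rewrite xpq Upq.
- move=> z z' zz'; have [k ek] : exists k, e k z <> e k z'.
    by apply/existsNP => ezz'; apply: zz'; exact: e_sep.
  exists k => n p q w lekn /(_ k lekn)[/= ez _] /(_ k lekn)[/= ez' _].
  by move=> /(_ k lekn)[/= ew _] /(_ k lekn)[/= ew' _]; apply: ek; congruence.
- move=> p; exact: play.
Qed.

(** * Well-orders and ladder systems *)

Lemma well_order_ind (d : Order.disp_t) (W : orderType d) (P : W -> Prop) :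
  @well_order W <=%O -> (forall a, (forall b, b < a -> P b) -> P a) ->
  forall a, P a.
Proof.
move=> wo IH a; apply: contrapT => nPa.
have [] := wo [pred b | `[< ~ P b >]]; first by exists a; apply/asboolP.
move=> b [[/asboolP nPb bmin] _]; apply: nPb; apply: IH => c cb.
by apply: contrapT => nPc; have := bmin c (asboolT nPc); rewrite leNgt cb.
Qed.

Section Ladders.
Context {d : Order.disp_t} {W : orderType d}.

Lemma Lim_finite_bound (a : W) (D : set W) : Lim W a -> finite_set D ->
  exists2 xi, xi < a & forall b, D b -> b < a -> b < xi.
Proof.
move=> [[b0 b0a] lima] /finite_seqP[s ->]; elim: s => [|c s [xi xia xiP]].
  by exists b0.
have [ca|ac] := ltP c a; last first.
  exists xi => // b; rewrite /= inE => /predU1P[->|]; last exact: xiP.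
  by rewrite ltNge ac.
have [c' cc' c'a] := lima _ ca.
exists (Order.max xi c'); first by rewrite gt_max xia.
move=> b; rewrite /= inE lt_max => /predU1P[->|bs ba].
  by rewrite cc' orbT.
by rewrite xiP.
Qed.

Lemma uniformizable_eventually (L : Lim W -> set W) :
  is_ladder_system L -> uniformizable L ->
  forall f : Lim W -> W -> nat, exists F : W -> nat, forall a : Lim W,
    exists2 xi, xi < val a & forall b, L a b -> xi <= b -> F b = f a b.
Proof.
move=> hL uL f; have [F FP] := uL (fun a b => f a (val b)).
exists F => a; have [[La _] _] := hL a.
have [xi xia xiP] :=
  Lim_finite_bound (set_mem (valP a)) (finite_image val (FP a)).
exists xi => // b Lb xib; apply: contrapT => Fb.
have : b < xi by apply: xiP; [exists (SigSub (mem_set Lb))|exact: La].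
by rewrite ltNge xib.
Qed.

Lemma ladder_ge (L : Lim W -> set W) (a : Lim W) (x y : W) :
  is_ladder_system L -> x < val a -> y < val a ->
  exists2 b, L a b & x <= b /\ y <= b.
Proof.
move=> hL xa ya; have [[_ cof] _] := hL a.
have [|b Lb] := cof (Order.max x y); first by rewrite gt_max xa.
by rewrite ge_max => /andP[]; exists b.
Qed.

(* On a greatest element, [wo_succ] is the identity. *)
Definition wo_succ (b : W) : W :=
  xget b [set c | b < c /\ forall x, b < x -> c <= x].

Lemma le_iter_wo_succ k b : b <= iter k wo_succ b.
Proof.
elim: k => //= k /le_trans; apply; rewrite /wo_succ.
by case: xgetP => // c _ [/ltW].
Qed.

Lemma wo_succE (b c : W) : b < c -> (forall x, b < x -> c <= x) -> wo_succ b = c.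
Proof.
move=> bc cP; rewrite /wo_succ; case: xgetP => [e _ [be eP]|/(_ c)[]//].
by apply/le_anti; rewrite eP// cP.
Qed.

Lemma decompose_wo_succ (wo : @well_order W <=%O) (a : W) :
  exists b k, a = iter k wo_succ b /\ ((forall c, b <= c) \/ Lim W b).
Proof.
move: a; apply: (well_order_ind wo) => a IH.
have [alim|] := pselect (Lim W a); first by exists a, 0%N; split=> //; right.
move=> /not_andP[/forallNP amin|/existsNP[b /not_implyP[ba /forall2NP bP]]].
  exists a, 0%N; split=> //; left=> c; rewrite leNgt; apply/negP; exact: amin.
have [c [k [bE cP]]] := IH b ba; exists c, k.+1; split=> //=.
rewrite -bE (wo_succE ba) // => x bx; rewrite leNgt; apply/negP => xa.
by case: (bP x).
Qed.

(** * Coding functions on [W] by reals *)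

Section Coding.
Variable L : Lim W -> set W.
Variable unif : (Lim W -> nat) -> W -> nat.

(* A value attached to a limit [a] is recovered from the restriction to [L a] of
   its uniformization. The list [k :: s] serves to recover the value at [a + k]
   of the function coded by [s]; so the functions [coding g s] together are
   determined by their restrictions to the finite ordinals. *)
Fixpoint coding (g : W -> nat) (s : seq nat) : W -> nat :=
  if s is k :: s' then unif (fun a => coding g s' (iter k wo_succ (val a))) else g.

Hypothesis wo : @well_order W <=%O.
Hypothesis hL : is_ladder_system L.
Hypothesis unifP : forall c a,
  exists2 xi, xi < val a & forall b, L a b -> xi <= b -> unif c b = c a.

(** Induction on [x] for all lists at once: if [x] is the [k]-th successor of a limit [b], some [c]
    in [L b] beyond both exceptional parts carries the value at [x] as its value for [k :: s]. *)
Lemma coding_eq g h (w : W) : (forall c, w <= c) ->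
  (forall s k, coding g s (iter k wo_succ w) = coding h s (iter k wo_succ w)) ->
  g = h.
Proof.
move=> wmin gh; apply/funext => x.
rewrite -[g x]/(coding g [::] x) -[h x]/(coding h [::] x).
move: x [::]; apply: (well_order_ind wo) => x IH s.
have [b [k [xE [bmin|blim]]]] := decompose_wo_succ wo x.
  by rewrite xE (_ : b = w) //; apply/le_anti; rewrite bmin wmin.
pose a : Lim W := SigSub (mem_set blim).
have [y ya yP] := unifP (fun a => coding g s (iter k wo_succ (val a))) a.
have [z za zP] := unifP (fun a => coding h s (iter k wo_succ (val a))) a.
have [c Lc [yc zc]] := ladder_ge hL ya za.
rewrite xE -(yP c) // -(zP c) //; apply: (IH c _ (k :: s)).
rewrite xE; apply: lt_le_trans (le_iter_wo_succ _ _).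
by have [[/(_ c Lc)]] := hL a.
Qed.

End Coding.

Lemma uniformizable_coding (L : Lim W -> set W) :
  @well_order W <=%O -> is_ladder_system L -> uniformizable L ->
  exists f : (W -> nat) -> (nat -> bool), injective f.
Proof.
move=> wo hL uL.
have [[w0 _]|/forallNP noW] := pselect (exists w : W, True); last first.
  by exists (fun _ _ => false) => g h _; apply/funext => w; case: (noW w).
have [w [[_ wmin] _]] := wo predT (ex_intro _ w0 isT).
have /choice[unif unifP] := fun c : Lim W -> nat =>
  uniformizable_eventually hL uL (fun a _ => c a).
(* The bit coded by [(s, k, i)] tells whether the value at the [k]-th successor of [w] is [i]. *)
exists (fun g n => if unpickle n is Some (s, k, i) then
  coding unif g s (iter k wo_succ w) == i :> nat else false).
move=> g h gh; apply: (coding_eq wo hL unifP (fun c => wmin c isT)) => s k.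
have /(congr1 (@^~ (pickle (s, k, coding unif g s (iter k wo_succ w))))) := gh.
by rewrite pickleK eqxx => /esym/eqP.
Qed.

Lemma Psi_coding (L : Lim W -> set W) :
  @well_order W <=%O -> is_ladder_system L -> uniformizable L ->
  exists f : (Psi L -> bool) -> (nat -> bool), injective f.
Proof.
move=> wo hL uL; have [f finj] := uniformizable_coding wo hL uL.
(* Both points over [b] are recorded; the second bit is a dummy unless [b] is a limit. *)
pose g (A : Psi L -> bool) b : nat := pickle (A (inl b),
  if insub b is Some a then A (inr a) else false).
exists (f \o g) => A B /finj gAB; apply/funext => -[b|a].
  by have /(congr1 (@^~ b))/(pcan_inj pickleK)[] := gAB.
by have /(congr1 (@^~ (val a)))/(pcan_inj pickleK)[_] := gAB; rewrite valK.
Qed.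

Lemma not_injective_powerset (T : Type) (h : (T -> bool) -> T) : ~ injective h.
Proof.
move=> hinj; pose D p := `[< exists2 A, h A = p & ~~ A p >].
have [DhD|nDhD] := boolP (D (h D)).
  by have /asboolP[A /hinj -> ] := DhD; rewrite DhD.
by move/asboolP: (nDhD); apply; exists D.
Qed.

(** * Clopen neighborhoods in [Psi L] *)

Section PsiSpace.
Context {L : Lim W -> set W}.
Hypothesis hL : is_ladder_system L.

Lemma Psi_locally_constant (X : Type) (f : Psi L -> X) :
  (forall a : Lim W, exists2 xi, xi < val a &
     forall b, L a b -> xi <= b -> f (inr a) = f (inl b)) ->
  locally_constant f.
Proof.
move=> fP [b|a]; first by [].
have [xi xia xiP] := fP a; exists xi => // p [->|[b [Lb xib] <-]] //=.
exact: xiP.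
Qed.

Lemma ladder_enumeration : exists l : Lim W -> nat -> W,
  (forall a, {mono l a : m n / (m < n)%N >-> m < n}) /\
  (forall a, range (l a) = L a).
Proof.
have /choice[l lP] : forall a, exists e : nat -> W,
    {mono e : m n / (m < n)%N >-> m < n} /\ range e = L a.
  by move=> a; have [_ [e]] := hL a; exists e.
by exists l; split=> a; case: (lP a).
Qed.

(** For [a'] other than [a], the part of [L a] below [a'] is bounded under [a']: by [a] if [a < a'],
    and by finiteness if [a' < a]. *)
Lemma Psi_basic_locally_constant (a : Lim W) (xi : W) : xi < val a ->
  locally_constant (Psi_basic a xi : set (Psi L)).
Proof.
move=> xia; apply: Psi_locally_constant => a'.
have [<-{a'}|aa'] := eqVneq a a'.
  exists xi => // b Lb xib; apply/propext; split=> _; last by left.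
  by right; exists b.
suff [x xa' xP] : exists2 x, x < val a' &
    forall b, L a b -> b < val a' -> b < x.
  exists x => // b Lb xb; apply/propext; split.
    by case=> [[]/esym/eqP|[]//]; rewrite (negPf aa').
  case=> // -[c [Lc _] [cb]]; move: Lc; rewrite {}cb => Lab.
  have [[/(_ b Lb) ba' _] _] := hL a'.
  by have := xP b Lab ba'; rewrite ltNge xb.
have [[La cof] [l lmono lL]] := hL a.
have [lt_aa'|] := ltP (val a) (val a'); first by exists (val a) => // b /La.
rewrite le_eqVlt => /predU1P[/val_inj a'a|lt_a'a].
  by rewrite a'a eqxx in aa'.
have [c] := cof _ lt_a'a; rewrite -lL => -[n _ <-{c}] a'n.
have [x xa' xP] :=
  Lim_finite_bound (set_mem (valP a')) (finite_image l (finite_II n)).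
exists x => // b [m _ <-{b}] ma'; apply: xP => //; exists m => //=.
by rewrite -lmono; exact: lt_le_trans a'n.
Qed.

End PsiSpace.

End Ladders.

(** * Separating functions and the cardinality contradiction *)

Theorem proposition5 (d : Order.disp_t) (W : orderType d) (hW : is_omega1 W)
    (L : Lim W -> set W) (hL : is_ladder_system L) :
  uniformizable L -> semi_proximal (Psi L).
Proof.
move=> uL; have [wo _ _] := hW.
have [l [lmono lL]] := ladder_enumeration hL.
have Ll a n : L a (l a n) by rewrite -lL; exists n.
have lt_la a n : l a n < val a by have [[/(_ _ (Ll a n))]] := hL a.
have [code code_inj] := Psi_coding wo hL uL.
pose rho (p : Psi L) := code (fun q => q == p).
have rho_inj : injective rho.
  by move=> p q /code_inj/(congr1 (@^~ p)); rewrite eqxx => /esym/eqP.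
have /choice[G GP] := fun i => uniformizable_eventually hL uL
  (fun a _ => rho (inr a) i : nat).
(* For almost all [b] in [L a], [H b] is the position of [b] in [L a]; thus
   [H b <= i] holds for finitely many [b] in [L a] only. *)
have [H HP] := uniformizable_eventually hL uL
  (fun a b => xget 0%N [set n | l a n = b]).
(* On a tail of [L a] the value is that at [inr a]: bit [i] and an empty list. Once [i] reaches
   [H b], the list is nonempty, which separates [inl b] from limit points; its growing length
   separates isolated points. *)
pose e i (p : Psi L) : nat * seq bool :=
  match p with
  | inl b => (G i b, if (H b <= i)%N then mkseq (rho p) i.+1 else [::])
  | inr a => (rho p i : nat, [::])
  end.
pose B (p : Psi L) j : set (Psi L) :=
  match p with inl b => [set p] | inr a => Psi_basic a (l a j) end.
apply: (@semi_proximal_of_clopen_base _ _ e B).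
- move=> i; apply: Psi_locally_constant => a /=.
  have [x xa xP] := GP i a; have [y ya yP] := HP a.
  (* From [l a i.+1] on, positions in [L a] exceed [i], so the list is empty. *)
  exists (Order.max (l a i.+1) (Order.max x y)).
    by rewrite !gt_max lt_la xa.
  move=> b Lb; rewrite !ge_max => /and3P[ib xb yb].
  rewrite (xP b) // ifF //; apply/negbTE; rewrite -ltnNge yP //.
  case: xgetP => [m _ /= mb|]; last first.
    by move: Lb; rewrite -lL => -[m _ mb] /(_ m)[].
  by move: ib; rewrite -mb leNgt lmono -leqNgt.
- move=> [b|a] [b'|a'] ee.
  + apply: rho_inj; apply/funext => k.
    have [] := ee (maxn k (maxn (H b) (H b'))).
    rewrite /= !leq_max !leqnn !orbT /= => _.
    move=> /(congr1 (nth false ^~ k)); rewrite !nth_mkseq //.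
      by rewrite ltnS leq_max leqnn.
    by rewrite ltnS leq_max leqnn.
  + by have [] := ee (H b); rewrite /= leqnn.
  + by have [] := ee (H b'); rewrite /= leqnn.
  + apply: rho_inj; apply/funext => k.
    by have [] := ee k; do 2!case: (rho _ k).
- move=> [b|a] j; last exact: Psi_basic_locally_constant.
  apply: Psi_locally_constant => a.
  have [xi xia xiP] := Lim_finite_bound (set_mem (valP a)) (finite_set1 b).
  exists xi => // b' Lb' xib'; apply/propext; split=> // -[b'b].
  have [[/(_ _ Lb') b'a _] _] := hL a.
  by have := xiP b' b'b b'a; rewrite ltNge xib'.
- by move=> [b|a] j //; left.
- move=> [b|a] A /=; first by exists 0%N => _ ->.
  move=> [xi xia xiA]; have [[_ cof] _] := hL a.
  have [c] := cof _ xia; rewrite -lL => -[n _ <-{c}] xin; exists n => p pn.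
  apply: xiA; case: pn => [->|[b [Lb nb] <-]]; first by left.
  by right; exists b => //; split=> //; exact: le_trans nb.
(* Composed with [code], such an [f] would inject the power set of [Psi L] into [Psi L]. *)
- move=> [f finj]; apply: (@not_injective_powerset _ (f \o code)).
  by move=> A A' /finj/code_inj.
Qed.
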